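(* Assume $\frac hr\le\omega$. Then the catenary $\rho_0$ is the unique minimizer of $\mathcal E_0$ on $X$.
   Context: Fix $h,r>0$. Let $X=\{\rho\in W^{1,1}(-h,h):\ \rho>0 \text{ on }[-h,h],\ \rho(-h)=\rho(h)=r\}$ (continuous representatives) and $\mathcal E_0(\rho)=\int_{-h}^h\rho\sqrt{1+(\rho')^2}\,dx$. Let $\Xi$ be the unique positive solution of $\xi\tanh\frac1\xi+\mathrm{sech}^2\frac1\xi=\xi$, and $\omega=\frac{1}{\Xi\cosh(1/\Xi)}$. Under $h/r\le\omega$, let $\Pi_0>0$ be the largest solution of $r=\Pi\cosh\frac{h}{\Pi}$ and $\rho_0(x)=\Pi_0\cosh\frac{x}{\Pi_0}$ on $[-h,h]$. *)

(* Defs.v *)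
From HB Require Import structures.
From mathcomp Require Import all_boot all_order all_algebra.
From mathcomp Require Import all_classical all_reals all_analysis.
Set Implicit Arguments. Unset Strict Implicit. Unset Printing Implicit Defensive.
Import Order.TTheory GRing.Theory Num.Theory.
Local Open Scope classical_set_scope.
Local Open Scope ring_scope.

Section Defs.
Variable R : realType.

Definition rcosh (x : R) : R := (expR x + expR (- x)) / 2.
Definition rsinh (x : R) : R := (expR x - expR (- x)) / 2.
Definition rtanh (x : R) : R := rsinh x / rcosh x.
Definition rsech (x : R) : R := 1 / rcosh x.

Definition Xi_eq (xi : R) : Prop :=
  xi * rtanh (1 / xi) + rsech (1 / xi) ^+ 2 = xi.

(* g is the weak (a.e.) derivative of the continuous representative rho on
   [-h,h]: g in L^1(-h,h) and rho(x) = rho(-h) + int_{-h}^x g for x in [-h,h].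
   This is exactly membership of rho in W^{1,1}(-h,h) (absolutely continuous
   representative) with rho' = g. *)
Definition weak_deriv_on (h : R) (rho g : R -> R) : Prop :=
  (@lebesgue_measure R).-integrable `[- h, h]%classic (EFin \o g) /\
  forall x, x \in `[- h, h] ->
    rho x = rho (- h) + Rintegral (@lebesgue_measure R) `[- h, x]%classic g.

Definition in_X (h r : R) (rho : R -> R) : Prop :=
  (exists g, weak_deriv_on h rho g) /\
  (forall x, x \in `[- h, h] -> 0 < rho x) /\
  rho (- h) = r /\ rho h = r.

(* E_0(rho) = int_{-h}^h rho sqrt(1 + rho'^2) dx, rho' = g the weak derivative *)
Definition E0 (h : R) (rho g : R -> R) : \bar R :=
  let I : set R := `[- h, h]%classic in
  (\int[@lebesgue_measure R]_(x in I) (rho x * Num.sqrt (1 + g x ^+ 2))%:E)%E.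

End Defs.

(* Main.v *)
Require Import Defs.
From mathcomp Require Import all_boot all_order all_algebra.
From mathcomp Require Import all_classical all_reals all_analysis.
From mathcomp Require Import measurable_realfun ring lra.
Set Implicit Arguments. Unset Strict Implicit. Unset Printing Implicit Defensive.
Import Order.TTheory GRing.Theory Num.Theory.
Import numFieldNormedType.Exports.
Local Open Scope classical_set_scope.
Local Open Scope ring_scope.

(* Let m be the minimum of rho, attained at z. Cauchy-Schwarz gives pointwise
     rho sqrt (1 + rho'^2) >= m + sqrt (rho^2 - m^2) |rho'|,
   and integrating over [-h, z] and [z, h] yields E(rho) >= 2 G(m), where
     G(m) = m h + int_m^r sqrt (t^2 - m^2) dt.
   The catenary has energy exactly 2 G(Pi0), and under the condition on h / r
   the value Pi0 is the strict minimum point of G on ]0, r]: with m = r / cosh s,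
   the condition says that the discontinuous Goldschmidt limit (m -> 0,
   G = r^2 / 2) does not beat the catenary.
   If E(rho) = E(rho0) then m = Pi0 and the lower bound is sharp on every
   subinterval. Comparing it there with the bounds given by constants p < m and
   letting p tend to m shows that m arcosh (rho / m) grows away from z at speed at
   most 1; it has to reach h at both ends, so z = 0 and
   m arcosh (rho (x) / m) = |x|. *)

(** * Hyperbolic functions and the reduced energy *)

Section Hyperbolic.
Context {R : realType}.
Implicit Types (s t u x y p h r m Xi Pi : R).

#[local] Instance is_derive_rcosh x : is_derive x 1 (@rcosh R) (rsinh x).
Proof.
have -> : @rcosh R = (2^-1) *: (expR + (expR \o -%R)).
  by apply/funext => z; rewrite /rcosh fctE /= [LHS]mulrC.
apply: is_derive_eq; rewrite /rsinh /GRing.scale /=; ring.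
Qed.

#[local] Instance is_derive_rsinh x : is_derive x 1 (@rsinh R) (rcosh x).
Proof.
have -> : @rsinh R = (2^-1) *: (expR - (expR \o -%R)).
  by apply/funext => z; rewrite /rsinh fctE /= [LHS]mulrC.
apply: is_derive_eq; rewrite /rcosh /GRing.scale /=; ring.
Qed.

Lemma rcosh0 : rcosh 0 = 1 :> R.
Proof. by rewrite /rcosh oppr0 expR0; lra. Qed.

Lemma rsinh0 : rsinh 0 = 0 :> R.
Proof. by rewrite /rsinh oppr0 expR0; lra. Qed.

Lemma rcoshN x : rcosh (- x) = rcosh x.
Proof. by rewrite /rcosh opprK addrC. Qed.

Lemma rsinhN x : rsinh (- x) = - rsinh x.
Proof. by rewrite /rsinh opprK -opprB mulNr. Qed.

Lemma rcosh2 x : rcosh x ^+ 2 = 1 + rsinh x ^+ 2.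
Proof. by rewrite /rcosh /rsinh; have := expRxMexpNx_1 x; nra. Qed.

Lemma rsinh_ge0 x : 0 <= x -> 0 <= rsinh x.
Proof.
move=> x0; rewrite /rsinh divr_ge0// subr_ge0 ler_expR; lra.
Qed.

Lemma rsinh_gt0 x : 0 < x -> 0 < rsinh x.
Proof.
move=> x0; rewrite /rsinh divr_gt0// subr_gt0 ltr_expR; lra.
Qed.

Lemma rcosh_gt0 x : 0 < rcosh x.
Proof. by rewrite /rcosh divr_gt0// addr_gt0// expR_gt0. Qed.

Lemma rcosh_ge1 x : 1 <= rcosh x.
Proof. by have := rcosh2 x; have := rcosh_gt0 x; nra. Qed.

Lemma derive_continuous_within (f df : R -> R) a b :
  (forall x, is_derive x 1 f (df x)) -> {within `[a, b], continuous f}.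
Proof.
move=> fdf; apply: derivable_within_continuous => x _.
by have [] := fdf x.
Qed.

Lemma derive_ge0_le (f df : R -> R) a b :
  (forall x, is_derive x 1 f (df x)) ->
  a <= b -> (forall x, a <= x <= b -> 0 <= df x) -> f a <= f b.
Proof.
move=> fdf ab df0; have cf := @derive_continuous_within f df a b fdf.
have [c cab fba] := @MVT_segment R f df a b ab (fun x _ => fdf x) cf.
by rewrite -subr_ge0 fba mulr_ge0 ?subr_ge0// df0// (itvP cab).
Qed.

Lemma derive_gt0_lt (f df : R -> R) a b :
  (forall x, is_derive x 1 f (df x)) ->
  a < b -> (forall x, a < x < b -> 0 < df x) -> f a < f b.
Proof.
move=> fdf ab df0; have cf := @derive_continuous_within f df a b fdf.
have [c cab fba] := @MVT R f df a b ab (fun x _ => fdf x) cf.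
by rewrite -subr_gt0 fba mulr_gt0 ?subr_gt0// df0// !(itvP cab).
Qed.

Lemma le_rcosh s t : 0 <= s -> s <= t -> rcosh s <= rcosh t.
Proof.
move=> s0 st; apply: (derive_ge0_le is_derive_rcosh st) => x /andP[sx _].
by rewrite rsinh_ge0// (le_trans s0).
Qed.

Lemma lt_rcosh s t : 0 <= s -> s < t -> rcosh s < rcosh t.
Proof.
move=> s0 st; apply: (derive_gt0_lt is_derive_rcosh st) => x /andP[sx _].
by rewrite rsinh_gt0// (le_lt_trans s0).
Qed.

Lemma le_rsinh s t : s <= t -> rsinh s <= rsinh t.
Proof.
move=> st; apply: (derive_ge0_le is_derive_rsinh st) => x _.
by rewrite ltW// rcosh_gt0.
Qed.

Lemma rcoshB s t : rcosh (s - t) = rcosh s * rcosh t - rsinh s * rsinh t.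
Proof. by rewrite /rcosh /rsinh opprB !expRD; field. Qed.

Lemma rsinhB s t : rsinh (s - t) = rsinh s * rcosh t - rcosh s * rsinh t.
Proof. by rewrite /rcosh /rsinh opprB !expRD; field. Qed.

(** * The inverse hyperbolic cosine and the area under a catenary slope *)

Definition acosh u : R := ln (u + Num.sqrt (u ^+ 2 - 1)).

Lemma acosh_ge0 u : 1 <= u -> 0 <= acosh u.
Proof. by move=> u1; rewrite ln_ge0// ler_wpDr// sqrtr_ge0. Qed.

Lemma acoshK u : 1 <= u -> rcosh (acosh u) = u.
Proof.
move=> u1; have q0 := sqrtr_ge0 (u ^+ 2 - 1).
have q2 : Num.sqrt (u ^+ 2 - 1) ^+ 2 = u ^+ 2 - 1.
  by rewrite sqr_sqrtr// subr_ge0; nra.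
rewrite /rcosh expRN /acosh lnK ?posrE; last lra.
have ? : u + Num.sqrt (u ^+ 2 - 1) != 0 by rewrite gt_eqF//; lra.
(* With q ^ 2 = u ^ 2 - 1 and w = u + q, the claim multiplied by 2 w reads w ^ 2 + 1 = 2 u w. *)
apply: (mulfI (_ : 2 * (u + Num.sqrt (u ^+ 2 - 1)) != 0)).
  by rewrite mulf_neq0.
have -> : 2 * (u + Num.sqrt (u ^+ 2 - 1)) *
  ((u + Num.sqrt (u ^+ 2 - 1) + (u + Num.sqrt (u ^+ 2 - 1))^-1) / 2) =
  (u + Num.sqrt (u ^+ 2 - 1)) ^+ 2 + 1 by field.
by move: q2; set q := Num.sqrt _ => q2; rewrite sqrrD q2; ring.
Qed.

Lemma rcoshK s : 0 <= s -> acosh (rcosh s) = s.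
Proof.
move=> s0; have c1 := rcosh_ge1 s; apply/eqP; rewrite eq_le !leNgt.
apply/andP; split; apply/negP => st.
  by have := lt_rcosh s0 st; rewrite acoshK// ltxx.
by have := lt_rcosh (acosh_ge0 c1) st; rewrite acoshK// ltxx.
Qed.

Lemma le_acosh u v : 1 <= u -> u <= v -> acosh u <= acosh v.
Proof.
move=> u1 uv; have v1 : 1 <= v by lra.
rewrite leNgt; apply/negP => st.
by have := lt_rcosh (acosh_ge0 v1) st; rewrite !acoshK// ltNge uv.
Qed.

(** For u < 1 the square root of a negative number is 0, so [acosh] agrees with [ln] there.
    Continuity is thus two-sided even at u = 1, which [acosh_gap] needs when y = m or z = m. *)
Lemma continuous_acosh u : 0 < u -> {for u, continuous acosh}.
Proof.
move=> u0; apply: (@continuous_comp _ _ _ (fun u => u + Num.sqrt (u ^+ 2 - 1))).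
  apply: cvgD; first exact: cvg_id.
  have c1 : (fun v : R => v ^+ 2 - 1) @ u --> (u ^+ 2 - 1).
    by apply: cvgB; [exact: exprn_continuous|exact: cvg_cst].
  by apply: cvg_comp; [exact: c1|exact: sqrt_continuous].
by apply: continuous_ln; rewrite ltr_wpDr// sqrtr_ge0.
Qed.

(* The area function: [catarea p y] is the integral of [sqrt (t ^ 2 - p ^ 2)]
   for t from p to y, computed by the substitution t = p cosh s. *)
Definition catarea p y : R :=
  let s := acosh (y / p) in p ^+ 2 / 2 * (rsinh s * rcosh s - s).

Lemma is_derive_sinhcosh s :
  is_derive s 1 (fun s => rsinh s * rcosh s - s) (2 * rsinh s ^+ 2).
Proof. by apply: is_derive_eq; rewrite /GRing.scale /=; have := rcosh2 s; lra. Qed.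

(** The slope of [catarea p] at t is sqrt (t ^ 2 - p ^ 2), which lies between 0 and its value at H.
    The proof works in the variable s, where t = p cosh s and the slope has no singularity at t =
    p. *)
Lemma catarea_lip p y z H : 0 < p -> p <= y -> y <= z -> z <= H ->
  0 <= catarea p z - catarea p y <= Num.sqrt (H ^+ 2 - p ^+ 2) * (z - y).
Proof.
move=> p0 py yz zH; rewrite /catarea.
have d1 w : p <= w -> 1 <= w / p by move=> ?; rewrite ler_pdivlMr// mul1r.
have pz : p <= z by lra.
have pH : p <= H by lra.
have ac w : p <= w -> p * rcosh (acosh (w / p)) = w.
  by move=> /d1 w1; rewrite acoshK// mulrC divfK// gt_eqF.
have s0 := acosh_ge0 (d1 _ py).
have st : acosh (y / p) <= acosh (z / p).
  by rewrite le_acosh ?d1// ler_pM2r// invr_gt0.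
have tT : acosh (z / p) <= acosh (H / p).
  by rewrite le_acosh ?d1// ler_pM2r// invr_gt0.
have -> : Num.sqrt (H ^+ 2 - p ^+ 2) = p * rsinh (acosh (H / p)).
  rewrite -[in LHS](ac _ pH); have := rcosh2 (acosh (H / p)).
  set C := rcosh _; set S := rsinh _ => CS.
  have -> : (p * C) ^+ 2 - p ^+ 2 = (p * S) ^+ 2.
    by rewrite (_ : _ - _ = p ^+ 2 * (C ^+ 2 - 1)); [rewrite CS|]; ring.
  by rewrite sqrtr_sqr ger0_norm// mulr_ge0 ?(ltW p0)// rsinh_ge0//; lra.
have := ac _ py; have := ac _ pz.
move: (acosh (y / p)) (acosh (z / p)) (acosh (H / p)) s0 st tT => s t T s0 st tT.
move=> <- <-; rewrite -mulrBr; apply/andP; split.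
  apply: mulr_ge0; first by rewrite divr_ge0// sqr_ge0.
  rewrite subr_ge0; apply: (derive_ge0_le is_derive_sinhcosh st) => x _.
  by rewrite mulr_ge0// sqr_ge0.
(* The upper bound is monotonicity on [s, t] of a function with derivative 2 sinh x (sinh T - sinh
   x), nonnegative for 0 <= x <= T. *)
have : 2 * rsinh T * rcosh s - (rsinh s * rcosh s - s) <=
       2 * rsinh T * rcosh t - (rsinh t * rcosh t - t).
  apply: (@derive_ge0_le (fun x => 2 * rsinh T * rcosh x - (rsinh x * rcosh x - x))
    (fun x => 2 * rsinh T * rsinh x - 2 * rsinh x ^+ 2) s t _ st).
    move=> x; have := is_derive_sinhcosh x => ?.
    by apply: is_derive_eq; rewrite /GRing.scale/=; ring.
  move=> x /andP[sx xt]; have : 0 <= rsinh x by rewrite rsinh_ge0//; lra.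
  have : rsinh x <= rsinh T by rewrite le_rsinh//; lra.
  nra.
move=> HH; have -> : p * rsinh T * (p * rcosh t - p * rcosh s) =
  p ^+ 2 / 2 * (2 * rsinh T * rcosh t - 2 * rsinh T * rcosh s) by field.
apply: ler_wpM2l; [by rewrite divr_ge0// sqr_ge0|lra].
Qed.

Lemma catarea_id p : 0 < p -> catarea p p = 0.
Proof.
move=> p0; rewrite /catarea divff ?gt_eqF// -rcosh0 rcoshK// rsinh0; ring.
Qed.

(** * The reduced energy as a function of s, where p = y / cosh s *)

Lemma catareaE y s : 0 < y -> 0 <= s ->
  catarea (y / rcosh s) y =
  y ^+ 2 * ((rsinh s * rcosh s - s) / (2 * rcosh s ^+ 2)).
Proof.
move=> y0 s0; rewrite /catarea; have cs := rcosh_gt0 s.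
have -> : y / (y / rcosh s) = rcosh s by field; rewrite !gt_eqF.
by rewrite rcoshK//; field; rewrite gt_eqF.
Qed.

(** With l = h / r and p = r / cosh s, this function is the reduced energy divided by r ^ 2. For s >
    0 the sign of its derivative is that of s / cosh s - l. *)
Lemma is_derive_catarea l s : is_derive s 1
  (fun s => (rsinh s * rcosh s - s) / (2 * rcosh s ^+ 2) + l / rcosh s)
  ((s / rcosh s - l) * (rsinh s / rcosh s ^+ 2)).
Proof.
have cs := rcosh_gt0 s.
have ? := is_derive_sinhcosh s.
have ? : 2 * rcosh s ^+ 2 != 0 by rewrite mulf_neq0// sqrf_eq0 gt_eqF.
have ? : rcosh s != 0 by rewrite gt_eqF.
apply: is_derive_eq; rewrite /GRing.scale/=.
by field; rewrite gt_eqF.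
Qed.

Lemma is_derive_id_div_rcosh s : is_derive s 1
  (fun s => s / rcosh s) ((rcosh s - s * rsinh s) / rcosh s ^+ 2).
Proof.
have cs := rcosh_gt0 s.
have ? : rcosh s != 0 by rewrite gt_eqF.
apply: is_derive_eq; rewrite /GRing.scale/=.
by field; rewrite gt_eqF.
Qed.

Lemma rsinh_lt_rcosh s : rsinh s < rcosh s.
Proof. by rewrite /rsinh /rcosh; have := expR_gt0 (- s); lra. Qed.

(** The numerator cosh x - x sinh x of the derivative is positive for x <= 1 because sinh < cosh.
    The range up to 1 is enough, since t (1 + tanh t) <= 1 forces t < 1. *)
Lemma id_div_rcosh_lt s t : 0 <= s -> s < t -> t <= 1 ->
  s / rcosh s < t / rcosh t.
Proof.
move=> s0 st t1; apply: (derive_gt0_lt is_derive_id_div_rcosh st) => x /andP[sx xt].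
rewrite divr_gt0 ?exprn_gt0 ?rcosh_gt0// subr_gt0.
have := rsinh_lt_rcosh x; have : 0 <= rsinh x by rewrite rsinh_ge0//; lra.
nra.
Qed.

Lemma expR_sub_sqr_gt0 u : 0 < u ->
  0 < expR u - 1 - u - (1 - expR (- u)) ^+ 2 / 2.
Proof.
move=> u0.
have d x : is_derive x 1 (fun u => expR u - 1 - u - (1 - expR (- u)) ^+ 2 / 2)
    ((1 - expR (- x)) * (expR x - expR (- x))).
  apply: is_derive_eq; rewrite /GRing.scale/=.
  by have := expRxMexpNx_1 x; lra.
have := derive_gt0_lt d u0.
rewrite oppr0 expR0 (_ : 1 - 1 + 0 - (1 - 1) ^+ 2 / 2 = 0); last by field.
apply=> x /andP[x0 _]; rewrite mulr_gt0// subr_gt0 ?ltr_expR ?expR_lt1; lra.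
Qed.

(** This is the case s = t + u of the minimality of t, with denominators cleared. Put T = tanh t, so
    that C = cosh u + T sinh u. Then (1 + T) (C sinh u - u) - (C - 1) ^ 2 is affine in T, and it is
    positive at T = 0 by [expR_sub_sqr_gt0] and at T = 1 by e ^ u > 1 + u. *)
Lemma catenoid_gt_right t u C : 0 < t -> t * (rcosh t + rsinh t) <= rcosh t ->
  0 < u -> C = rcosh (t + u) / rcosh t ->
  t * (C - 1) ^+ 2 < C * rsinh u - u.
Proof.
move=> t0 tle u0 CE.
have K0 := rcosh_gt0 t.
have S0 := rsinh_gt0 t0.
have SK := rsinh_lt_rcosh t.
pose T := rsinh t / rcosh t.
have T0 : 0 < T by rewrite divr_gt0.
have T1 : T < 1 by rewrite ltr_pdivrMr// mul1r.
have tT : t * (1 + T) <= 1.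
  have -> : t * (1 + T) = t * (rcosh t + rsinh t) / rcosh t.
    by rewrite /T; field; rewrite gt_eqF.
  by rewrite ler_pdivrMr// mul1r.
have -> : C = rcosh u + T * rsinh u.
  rewrite CE -[u in t + u]opprK rcoshB rcoshN rsinhN /T.
  by field; rewrite gt_eqF.
have A := expR_sub_sqr_gt0 u0.
have B : 0 < expR u - 1 - u.
  by have := @expR_gt1Dx _ u; rewrite gt_eqF// => /(_ isT); lra.
have XY := expRxMexpNx_1 u.
rewrite /rcosh /rsinh; move: (expR u) (expR (- u)) A B XY => X Y A B XY.
rewrite -subr_gt0.
set E := (X in 0 < X).
(* The interpolation between the values at T = 0 and T = 1. *)
have : 0 < (1 - T) * (X - 1 - u - (1 - Y) ^+ 2 / 2) + T * (2 * (X - 1 - u)).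
  apply: addr_gt0; apply: mulr_gt0 => //; [lra|].
  by apply: mulr_gt0.
set D := (X in 0 < X -> _) => D0.
set C' := (X + Y) / 2 + T * ((X - Y) / 2).
have HH : (1 + T) * (C' * ((X - Y) / 2) - u) - (C' - 1) ^+ 2 = D.
  have X0 : X != 0 by apply/eqP => X0; move: XY; rewrite X0; lra.
  rewrite /C' /D; have -> : Y = X^-1 by apply: (mulfI X0); rewrite XY divff.
  by field.
(* Here t (1 + T) <= 1 replaces the coefficient of (C - 1) ^ 2 by the larger value 1. *)
have : 0 < (1 + T) * E.
  rewrite (lt_le_trans D0)// -HH /E -/C' -subr_ge0.
  rewrite (_ : _ - _ = (1 - t * (1 + T)) * (C' - 1) ^+ 2); last by ring.
  by rewrite mulr_ge0 ?sqr_ge0// subr_ge0.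
by rewrite pmulr_rgt0//; lra.
Qed.

(* With p = r / cosh s and h = r t / cosh t, both sides are (catarea p r + p h) / r^2;
   the condition on t says t (1 + tanh t) <= 1. *)
Lemma catenary_param_min t s : 0 < t -> t * (rcosh t + rsinh t) <= rcosh t ->
  0 <= s -> s != t ->
  (rsinh t * rcosh t - t) / (2 * rcosh t ^+ 2) + t / rcosh t / rcosh t <
  (rsinh s * rcosh s - s) / (2 * rcosh s ^+ 2) + t / rcosh t / rcosh s.
Proof.
move=> t0 tle s0 st.
have K0 := rcosh_gt0 t.
have S0 := rsinh_gt0 t0.
(* Left of t the derivative is negative, because x / cosh x increases up to t < 1. Right of t its
   sign changes again, since x / cosh x tends to 0, so that side needs the global comparison
   [catenoid_gt_right]. *)
case: (ltgtP s t) st => // [st _|ts _].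
  rewrite -ltrN2.
  pose F s := - ((rsinh s * rcosh s - s) / (2 * rcosh s ^+ 2) +
                 t / rcosh t / rcosh s).
  apply: (@derive_gt0_lt F (fun x => - ((x / rcosh x - t / rcosh t) *
            (rsinh x / rcosh x ^+ 2))) _ _ _ st).
    by move=> x; have := is_derive_catarea (t / rcosh t) x => ?; apply: is_derive_eq.
  move=> x /andP[sx xt]; rewrite -mulNr opprB mulr_gt0//.
    by rewrite subr_gt0 id_div_rcosh_lt//; [lra|nra].
  by rewrite divr_gt0 ?exprn_gt0 ?rcosh_gt0// rsinh_gt0//; lra.
have u0 : 0 < s - t by lra.
have := catenoid_gt_right t0 tle u0; rewrite [t + _]addrC subrK => /(_ _ erefl).
have Cs := rcosh_gt0 s.
rewrite rsinhB -[_ < _ - _]subr_gt0 -[in X in _ -> X]subr_gt0.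
set D := (X in 0 < X -> _) => D0.
rewrite (_ : _ - _ = D / (2 * rcosh s ^+ 2)).
  by rewrite divr_gt0// mulr_gt0// exprn_gt0.
by rewrite /D; field; rewrite !gt_eqF.
Qed.

(* The critical ratio 1/Xi is the root of s (1 + tanh s) = 1. *)
Lemma catenary_ratio_small h r Xi Pi0 : 0 < h -> 0 < r -> 0 < Xi -> Xi_eq Xi ->
  0 < Pi0 -> r = Pi0 * rcosh (h / Pi0) ->
  (forall Pi : R, 0 < Pi -> r = Pi * rcosh (h / Pi) -> Pi <= Pi0) ->
  h / r <= 1 / (Xi * rcosh (1 / Xi)) ->
  h / Pi0 * (rcosh (h / Pi0) + rsinh (h / Pi0)) <= rcosh (h / Pi0).
Proof.
move=> h0 r0 X0 XE P0 PE Pmax hr; set t := h / Pi0.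
pose s0 : R := 1 / Xi.
have s00 : 0 < s0 by rewrite divr_gt0.
have XiE : Xi = s0^-1 by rewrite /s0 div1r invrK.
have C0 := rcosh_gt0 s0.
have s0E : s0 * (rcosh s0 + rsinh s0) = rcosh s0.
  move: XE; rewrite /Xi_eq -/s0 XiE /rtanh /rsech => XE.
  have XE' : rsinh s0 * rcosh s0 + s0 = rcosh s0 ^+ 2.
    have := congr1 (fun z => z * (s0 * rcosh s0 ^+ 2)) XE.
    rewrite mulKf ?gt_eqF// => <-; field; rewrite !gt_eqF//.
  (* Since (cosh + sinh) (cosh - sinh) = 1, multiplying the goal by cosh - sinh gives s = cosh ^ 2 -
     sinh cosh, which is the equation for Xi. *)
  apply: (mulIf (_ : rcosh s0 - rsinh s0 != 0)).
    by rewrite subr_eq0 gt_eqF// rsinh_lt_rcosh.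
  by move: XE'; have := rcosh2 s0; nra.
(* The bound on h / r provides a root s of s / cosh s = h / r below s0. Then h / s solves the
   equation of Pi0, and maximality of Pi0 gives t <= s <= s0. *)
have [s /[!in_itv]/= /andP[s_ge0 ss0] sE] :
    exists2 s, s \in `[0, s0] & s / rcosh s = h / r.
  apply: IVT; first exact: ltW.
    exact: derive_continuous_within is_derive_id_div_rcosh.
  have k0 : 0 < h / r by exact: divr_gt0.
  have k1 : h / r <= s0 / rcosh s0.
    by move: hr; rewrite -/s0 XiE; congr (_ <= _); field; rewrite !gt_eqF.
  by rewrite mul0r min_l ?max_r; lra.
have s_gt0 : 0 < s.
  rewrite lt_neqAle s_ge0 andbT; apply/eqP => s0'.
  by move: sE; rewrite -s0' mul0r => /esym/eqP; rewrite gt_eqF// divr_gt0.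
have ts0 : t <= s0.
  apply: le_trans ss0.
  have Ph : h / s <= Pi0.
    apply: Pmax; first exact: divr_gt0.
    have Cs := rcosh_gt0 s.
    have -> : h / (h / s) = s by field; rewrite !gt_eqF.
    move: sE => /(congr1 (fun z => z * (r * rcosh s / s))) => sE.
    transitivity (s / rcosh s * (r * rcosh s / s)); first by field; rewrite !gt_eqF.
    by rewrite sE; field; rewrite !gt_eqF.
  by rewrite /t ler_pdivrMr// mulrC -ler_pdivrMr.
have t0 : 0 < t by rewrite divr_gt0.
(* This is tanh t <= tanh s0 with denominators cleared; together with t <= s0 it carries the
   relation at s0 over to t. *)
have SB : 0 <= rsinh s0 * rcosh t - rcosh s0 * rsinh t.
  by rewrite -rsinhB rsinh_ge0// subr_ge0.
have Ct := rcosh_gt0 t; have St := rsinh_gt0 t0.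
rewrite -(ler_pM2r C0).
apply: (@le_trans _ _ (s0 * (rcosh s0 + rsinh s0) * rcosh t)); last by rewrite s0E mulrC.
apply: (@le_trans _ _ (s0 * (rcosh t + rsinh t) * rcosh s0)); last by nra.
by apply: ler_wpM2r; [exact: ltW|apply: ler_wpM2r => //; lra].
Qed.

(** Dividing by r ^ 2 and writing m = r / cosh s, Pi0 = r / cosh t reduces this to
    [catenary_param_min]. *)
Lemma cat_energy_min h r Xi Pi0 m : 0 < h -> 0 < r -> 0 < Xi -> Xi_eq Xi ->
  0 < Pi0 -> r = Pi0 * rcosh (h / Pi0) ->
  (forall Pi : R, 0 < Pi -> r = Pi * rcosh (h / Pi) -> Pi <= Pi0) ->
  h / r <= 1 / (Xi * rcosh (1 / Xi)) ->
  0 < m -> m <= r -> m != Pi0 ->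
  Pi0 * h + catarea Pi0 r < m * h + catarea m r.
Proof.
move=> h0 r0 X0 XE P0 PE Pmax hr m0 mr mP.
have tle := catenary_ratio_small h0 r0 X0 XE P0 PE Pmax hr.
pose t := h / Pi0; pose s := acosh (r / m).
have t0 : 0 < t by rewrite divr_gt0.
have Ct := rcosh_gt0 t.
have rm : 1 <= r / m by rewrite ler_pdivlMr// mul1r.
have s0 : 0 <= s by exact: acosh_ge0.
have Cs := rcosh_gt0 s.
have sm : m = r / rcosh s by rewrite acoshK//; field; rewrite !gt_eqF.
have Pt : Pi0 = r / rcosh t by rewrite PE -/t mulfK// gt_eqF.
have st : s != t by apply: contra_neq mP => st; rewrite sm Pt st.
have hE : h = r * (t / rcosh t).
  by rewrite PE -/t /t; field; rewrite !gt_eqF.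
rewrite sm {1 2}Pt !catareaE//; last exact: ltW.
rewrite [in X in X < _]hE [in X in _ < X]hE.
have := catenary_param_min t0 tle s0 st; rewrite -/t.
rewrite -(ltr_pM2l (exprn_gt0 2 r0)).
by congr (_ < _); field; rewrite !gt_eqF.
Qed.

(* As a function of p, [catarea p y] has derivative [- p * acosh (y / p)]; the
   substitution p = y / cosh s avoids the singularity at p = y. *)
Lemma catarea_mean_value p m y : 0 < p -> p < m -> m <= y ->
  exists2 q, p <= q <= m &
    catarea p y - catarea m y = q * acosh (y / q) * (m - p).
Proof.
move=> p0 pm my.
have m0 : 0 < m by lra. have y0 : 0 < y by lra.
have ge1 q : 0 < q -> q <= y -> 1 <= y / q by move=> *; rewrite ler_pdivlMr// mul1r.
have yE q : 0 < q -> q <= y -> y / rcosh (acosh (y / q)) = q.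
  by move=> q0 qy; rewrite acoshK ?ge1//; field; rewrite !gt_eqF.
have sm0 := acosh_ge0 (ge1 _ m0 my).
have py : p <= y by lra.
have smp : acosh (y / m) < acosh (y / p).
  rewrite lt_neqAle le_acosh ?ge1//; last first.
    by rewrite ler_pM2l// lef_pV2 ?posrE// ltW.
  rewrite andbT; apply: contra_ltN pm => /eqP e.
  by rewrite -(yE _ m0 my) -(yE _ p0 py) e.
have sp0 : 0 <= acosh (y / p) by lra.
have := catareaE y0 sm0; have := catareaE y0 sp0; rewrite !yE//.
(* The slope l makes [catarea q y + l * q] take equal values at q = p and q = m. The mean value
   theorem in s then yields a critical point c, where c / cosh c = l / y, and q = y / cosh c is the
   required point. *)
pose l := (catarea p y - catarea m y) / (m - p).
have dF s := is_derive_catarea (l / y) s.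
pose F s := (rsinh s * rcosh s - s) / (2 * rcosh s ^+ 2) + l / y / rcosh s.
have [c /[!in_itv]/= /andP[mc cp] Fc Ep Em] :=
  MVT smp (fun s _ => dF s) (derive_continuous_within dF).
have FE q : 0 < q -> q <= y -> catarea q y = y ^+ 2 * ((rsinh (acosh (y / q)) *
    rcosh (acosh (y / q)) - acosh (y / q)) / (2 * rcosh (acosh (y / q)) ^+ 2)) ->
    y ^+ 2 * F (acosh (y / q)) = catarea q y + l * q.
  move=> q0 qy ->; rewrite /F mulrDr; congr (_ + _); rewrite -[in RHS](yE _ q0 qy).
  by field; rewrite !gt_eqF// rcosh_gt0.
have Cc := rcosh_gt0 c.
have Sc : 0 < rsinh c by rewrite rsinh_gt0//; lra.
have : y ^+ 2 * (F (acosh (y / p)) - F (acosh (y / m))) = 0.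
  rewrite mulrBr !FE// /l; field; rewrite subr_eq0 gt_eqF//.
rewrite /F Fc => Z.
have /eqP : c / rcosh c - l / y = 0.
  apply: (mulIf (_ : y ^+ 2 * (rsinh c / rcosh c ^+ 2 *
                     (acosh (y / p) - acosh (y / m))) != 0)).
    rewrite gt_eqF//; apply: mulr_gt0; first exact: exprn_gt0.
    apply: mulr_gt0; last by rewrite subr_gt0.
    by apply: divr_gt0 => //; exact: exprn_gt0.
  by rewrite mul0r -[RHS]Z; ring.
rewrite subr_eq0 => /eqP lE.
exists (y / rcosh c).
  apply/andP; split.
    rewrite -[leLHS](yE _ p0 py) ler_pM2l// lef_pV2 ?posrE ?rcosh_gt0//.
    by apply: le_rcosh; lra.
  rewrite -[leRHS](yE _ m0 my) ler_pM2l// lef_pV2 ?posrE ?rcosh_gt0//.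
  by apply: le_rcosh; lra.
rewrite (_ : y / (y / rcosh c) = rcosh c); last by field; rewrite !gt_eqF.
rewrite rcoshK; last lra.
rewrite (_ : y / rcosh c * c = y * (c / rcosh c)); last by field; rewrite gt_eqF.
rewrite lE /l; field; rewrite subr_eq0 !gt_eqF//.
Qed.

(** By hypothesis p l + catarea p z - catarea p y is at most its value at m for p < m, so its left
    derivative at m, which is l - m acosh (z / m) + m acosh (y / m), is nonnegative. The derivative
    is replaced by [catarea_mean_value] and continuity of q acosh (w / q) at m. *)
Lemma acosh_gap m l y z : 0 < m -> m <= y -> m <= z ->
  (forall p, 0 < p -> p < m ->
    p * l + (catarea p z - catarea p y) <= m * l + (catarea m z - catarea m y)) ->
  m * acosh (z / m) - m * acosh (y / m) <= l.
Proof.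
move=> m0 my mz H; rewrite leNgt; apply/negP => gap.
pose e := (m * acosh (z / m) - m * acosh (y / m) - l) / 3.
have e0 : 0 < e by rewrite divr_gt0//; lra.
have cA w : m <= w -> (fun q : R => q * acosh (w / q)) @ m --> m * acosh (w / m).
  move=> mw; apply: cvgM; first exact: cvg_id.
  have c1 : (fun q : R => w / q) @ m --> w / m.
    apply: cvgM; first exact: cvg_cst.
    by apply: cvgV; [rewrite gt_eqF|exact: cvg_id].
  apply: cvg_comp c1 _; apply: continuous_acosh; rewrite divr_gt0//; lra.
have [dz /= dz0 Hz] : \forall q \near m, `|m * acosh (z / m) - q * acosh (z / q)| < e.
  by have /cvgrPdist_lt/(_ _ e0) := cA z mz.
have [dy /= dy0 Hy] : \forall q \near m, `|m * acosh (y / m) - q * acosh (y / q)| < e.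
  by have /cvgrPdist_lt/(_ _ e0) := cA y my.
pose d := Num.min (m / 2) (Num.min (dz / 2) (dy / 2)).
have d0 : 0 < d by rewrite !lt_min !divr_gt0.
have [d1 d2 d3] : [/\ d <= m / 2, d <= dz / 2 & d <= dy / 2].
  by rewrite /d !ge_min !lexx !orbT.
clearbody d; have pm : m - d < m by lra.
have p0 : 0 < m - d by lra.
have [q1 q1m E1] := catarea_mean_value p0 pm my.
have [q2 q2m E2] := catarea_mean_value p0 pm mz.
have := H _ p0 pm.
have : `|m * acosh (z / m) - q2 * acosh (z / q2)| < e.
  by apply: Hz; rewrite /ball_/= ger0_norm; lra.
have : `|m * acosh (y / m) - q1 * acosh (y / q1)| < e.
  by apply: Hy; rewrite /ball_/= ger0_norm; lra.
move: E1 E2; rewrite !ltr_norml (_ : m - (m - d) = d); last by ring.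
move: (q1 * acosh _) (q2 * acosh _) => A1 A2 E1 E2 /andP[lt1 _] /andP[_ lt2] HH.
have : d * (A2 - A1 - l) <= 0.
  rewrite (_ : _ * _ = A2 * d - A1 * d - d * l); last by ring.
  rewrite -E1 -E2; move: (catarea (m - d) y) (catarea (m - d) z) HH => u v HH.
  lra.
rewrite pmulr_rle0// => ?.
rewrite /e in lt1 lt2 e0; lra.
Qed.

End Hyperbolic.

(** * The lower bound for curves *)

Section Integral.
Context {R : realType}.
Notation mu := (@lebesgue_measure R).
Implicit Types (f : R -> R) (a b c : R).

Lemma integrable_sub f a b c d : c <= a -> b <= d ->
  mu.-integrable `[c, d] (EFin \o f) -> mu.-integrable `[a, b] (EFin \o f).
Proof.
by move=> ca bd; apply: integrableS => //; apply: subset_itvScc; rewrite bnd_simp.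
Qed.

Lemma Rintegral_cat f a b c : a <= b -> b <= c ->
  mu.-integrable `[a, c] (EFin \o f) ->
  \int[mu]_(x in `[a, c]) f x =
  \int[mu]_(x in `[a, b]) f x + \int[mu]_(x in `[b, c]) f x.
Proof.
move=> ab bc fi; apply/eqP; rewrite addrC -subr_eq; apply/eqP.
rewrite (@Rintegral_itvB _ _ _ _ b) ?bnd_simp//.
rewrite Rintegral_itv_obnd_cbnd//.
by apply: integrableS fi => //; apply: subset_itv; rewrite bnd_simp.
Qed.

Lemma Rintegral_itv_cst a b k : a <= b -> \int[mu]_(x in `[a, b]) k = k * (b - a).
Proof.
move=> ab; rewrite Rintegral_cst//= lebesgue_measure_itv/= lte_fin.
case: ltP => [_|ba]; first by rewrite -EFinD.
by rewrite (_ : b - a = 0)//; lra.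
Qed.

Lemma integrable_itv_cst a b k : mu.-integrable `[a, b] (EFin \o (fun=> k)).
Proof.
apply: continuous_compact_integrable; first exact: segment_compact.
by apply: continuous_subspaceT => x; exact: cvg_cst.
Qed.

Lemma integrable_scale f a b k : mu.-integrable `[a, b] (EFin \o f) ->
  mu.-integrable `[a, b] (EFin \o (fun x => k * f x)).
Proof.
move=> fi; have j1 : mu.-integrable `[a, b] (fun x => k%:E * (EFin \o f) x)%E.
  exact: integrableZl.
exact: j1.
Qed.

Lemma integrable_lin f1 f2 a b k1 k2 :
  mu.-integrable `[a, b] (EFin \o f1) -> mu.-integrable `[a, b] (EFin \o f2) ->
  mu.-integrable `[a, b] (EFin \o (fun x => k1 * f1 x + k2 * f2 x)).
Proof.
move=> i1 i2.
have := integrable_scale k2 i2; have := integrable_scale k1 i1.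
exact: integrableD.
Qed.

Lemma Rintegral_lin f1 f2 a b k1 k2 :
  mu.-integrable `[a, b] (EFin \o f1) -> mu.-integrable `[a, b] (EFin \o f2) ->
  \int[mu]_(x in `[a, b]) (k1 * f1 x + k2 * f2 x) =
  k1 * \int[mu]_(x in `[a, b]) f1 x + k2 * \int[mu]_(x in `[a, b]) f2 x.
Proof.
move=> i1 i2; rewrite RintegralD//; last 2 first.
- exact: integrable_scale.
- exact: integrable_scale.
by rewrite !RintegralZl.
Qed.

(** Turns a bound valid on all pieces shorter than d into one on [a, b], by induction on the number
    of steps of length d / 2. *)
Lemma small_step_le (D : R -> R) a b d : 0 < d -> a <= b ->
  (forall x y, a <= x -> x <= y -> y <= b -> y - x < d -> D x <= D y) ->
  D a <= D b.
Proof.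
move=> d0 ab H.
have [n nd] : exists n, b - a < d / 2 * n.+1%:R.
  exists (Num.truncn ((b - a) / (d / 2))).
  rewrite mulrC -ltr_pdivrMr ?divr_gt0//.
  exact: truncnS_gt.
suff K k : forall y, a <= y -> y <= b -> y - a < d / 2 * k.+1%:R -> D a <= D y.
  exact: (K n).
elim: k => [|k IH] y ay yb yd.
  by apply: H => //; lra.
have [yd'|yd'] := ltP (y - a) (d / 2 * k.+1%:R); first exact: IH.
have dk : 0 < d / 2 * k.+1%:R by rewrite mulr_gt0// divr_gt0.
rewrite -[k.+2%:R]natr1 mulrDr mulr1 in yd.
have [da|da] := ltP (y - a) d; first exact: H.
move: (d / 2 * k.+1%:R) dk yd yd' IH => Z dk yd yd' IH.
apply: (@le_trans _ _ (D (y - d / 2))); [apply: IH|apply: H]; lra.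
Qed.

End Integral.

(** * Absolutely continuous curves: regularity, integrability and the lower bound *)

Section Curve.
Context {R : realType}.
Notation mu := (@lebesgue_measure R).
Variables (h : R) (rho g : R -> R).
Hypothesis rhog : weak_deriv_on h rho g.

Lemma weak_increment a b : - h <= a -> a <= b -> b <= h ->
  rho b - rho a = \int[mu]_(x in `[a, b]) g x.
Proof.
move=> ha ab bh; have [gi E] := rhog.
have ah : a \in `[- h, h] by rewrite in_itv/=; lra.
have bh' : b \in `[- h, h] by rewrite in_itv/=; lra.
rewrite (E b bh') (E a ah) (@Rintegral_cat _ _ (- h) a b)//; first lra.
exact: integrable_sub gi.
Qed.

(** Absolute continuity of the integral of |g|, with [g] extended by zero outside [-h, h]. *)
Lemma weak_unif_cont e : 0 < e -> exists2 d, 0 < d & forall a b,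
  - h <= a -> a <= b -> b <= h -> b - a < d -> `|rho b - rho a| < e.
Proof.
move=> e0; have [gi E] := rhog.
have gi' : mu.-integrable setT (EFin \o g \_ `[- h, h]).
  by rewrite -restrict_EFin; apply/integrable_restrict => //=; rewrite setTI.
have [d [d0 H]] := integral_normr_continuous gi' e0.
exists d => // a b ha ab bh abd.
have muab : (mu `[a, b]%classic < d%:E)%E.
  rewrite lebesgue_measure_itv/= lte_fin; case: ifP => _; last by rewrite lte_fin.
  by rewrite -EFinD lte_fin.
have := H _ (measurable_itv _) muab; apply: le_lt_trans.
rewrite weak_increment//.
have gab := integrable_sub ha bh gi.
apply: (le_trans (le_normr_Rintegral _ gab)) => //.
rewrite le_eqVlt; apply/orP; left; apply/eqP/eq_Rintegral => x.
rewrite inE/= in_itv/= => /andP[ax xb].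
by rewrite patchE mem_set//= in_itv/=; lra.
Qed.

Lemma weak_continuous : {within `[- h, h], continuous rho}.
Proof.
apply/subspace_continuousP => x /=; rewrite in_itv/= => /andP[hx xh].
apply/cvgrPdist_lt => e e0.
have [d d0 H] := weak_unif_cont e0.
rewrite near_withinE; near=> y; rewrite /= in_itv/= => /andP[hy yh].
have xy : `|x - y| < d.
  by near: y; exact: cvgr_dist_lt.
have [xley|/ltW ylex] := leP x y.
  by rewrite distrC H//; move: xy; rewrite distrC ger0_norm// subr_ge0.
by rewrite H//; move: xy; rewrite ger0_norm// subr_ge0.
Unshelve. all: by end_near. Qed.

Lemma weak_measurable : measurable_fun `[- h, h] g.
Proof. by have [/integrableP[+ _] _] := rhog => /measurable_EFinP. Qed.

Definition arclen x := Num.sqrt (1 + g x ^+ 2).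

Lemma measurable_arclen : measurable_fun `[- h, h] arclen.
Proof.
have m1 : measurable_fun `[- h, h] (fun x => 1 + g x ^+ 2).
  by apply: measurable_funD => //; apply: measurable_funX; exact: weak_measurable.
have m2 : measurable_fun setT (@Num.sqrt R).
  by apply: continuous_measurable_fun; exact: sqrt_continuous.
exact: measurableT_comp m2 m1.
Qed.

Lemma arclen_ge0 x : 0 <= arclen x. Proof. exact: sqrtr_ge0. Qed.

(* Cauchy-Schwarz for (p, q) and (1, g x). *)
Lemma arclen_ge p q H x : 0 <= H -> p ^+ 2 + q ^+ 2 = H ^+ 2 ->
  p + q * `|g x| <= H * arclen x.
Proof.
move=> H0 pq; rewrite /arclen -(real_normK (num_real (g x))).
set G := `|g x|; have G2 := sqr_sqrtr (_ : 0 <= 1 + G ^+ 2).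
have {}G2 := G2 (addr_ge0 ler01 (sqr_ge0 _)).
have W0 := sqrtr_ge0 (1 + G ^+ 2).
move: (Num.sqrt _) G2 W0 => W G2 W0.
have [neg|pos] := ltP (p + q * G) 0.
  by apply: (le_trans (ltW neg)); exact: mulr_ge0.
rewrite -(@ler_pXn2r _ 2)// ?nnegrE ?mulr_ge0//.
rewrite exprMn G2 -pq -subr_ge0.
rewrite (_ : _ - _ = (p * G - q) ^+ 2); last by ring.
exact: sqr_ge0.
Qed.

(** Domination by sqrt (1 + g ^ 2) <= 1 + |g|. *)
Lemma integrable_arclen : mu.-integrable `[- h, h] (EFin \o arclen).
Proof.
have [gi _] := rhog.
have i1 : mu.-integrable `[- h, h] (fun x => (1%:E + `|(EFin \o g) x|)%E).
  apply: integrableD => //; first exact: integrable_itv_cst.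
  exact: integrable_abse.
apply: (le_integrable _ _ _ i1) => //.
  by apply/measurable_EFinP; exact: measurable_arclen.
move=> x _ /=; rewrite lee_fin ger0_norm ?arclen_ge0//.
rewrite [leRHS]ger0_norm ?addr_ge0// /arclen.
rewrite -(@ler_pXn2r _ 2)// ?nnegrE ?sqrtr_ge0 ?addr_ge0//.
rewrite sqr_sqrtr ?addr_ge0 ?sqr_ge0// -(real_normK (num_real (g x))).
by have := normr_ge0 (g x); nra.
Qed.

Definition energy x := rho x * arclen x.

Lemma integrable_energy : 0 <= h -> mu.-integrable `[- h, h] (EFin \o energy).
Proof.
move=> h0.
have mr : measurable_fun `[- h, h] rho.
  apply: subspace_continuous_measurable_fun => //; exact: weak_continuous.
have cn : {within `[- h, h], continuous (fun x => `|rho x|)}.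
  by move=> x; apply: cvg_norm; exact: weak_continuous.
have hh : - h <= h by lra.
have [c cI Hc] := EVT_max hh cn.
have i1 : mu.-integrable `[- h, h] (fun x => `|rho c|%:E * (EFin \o arclen) x)%E.
  by apply: integrableZl => //; exact: integrable_arclen.
apply: (le_integrable _ _ _ i1) => //.
  apply/measurable_EFinP; apply: measurable_funM => //; exact: measurable_arclen.
move=> x xI /=; rewrite lee_fin !normrM normr_id.
by apply: ler_wpM2r => //; exact: Hc.
Qed.

(** Each curve has finite energy, so energies can be compared as real numbers. *)
Lemma E0E : 0 <= h -> E0 h rho g = (\int[mu]_(x in `[- h, h]) energy x)%:E.
Proof.
move=> h0; rewrite /E0 /Rintegral fineK//.
by apply: integrable_fin_num => //; exact: integrable_energy.
Qed.

(** The number q = sqrt (H ^ 2 - p ^ 2) serves twice: it is a Lipschitz constant of [catarea p] on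
    [p, H], and (p, q) has norm H in the Cauchy-Schwarz bound [arclen_ge]. *)
Lemma catarea_local p H a b : - h <= a -> a <= b -> b <= h -> 0 < p ->
  (forall x, a <= x <= b -> p <= rho x <= H) ->
  p * (b - a) + `|catarea p (rho b) - catarea p (rho a)| <=
  H * \int[mu]_(x in `[a, b]) arclen x.
Proof.
move=> ha ab bh p0 Hx.
have [gi _] := rhog; have gi' := integrable_sub ha bh gi.
have /andP[pa aH] := Hx a ltac:(lra); have /andP[pb bH] := Hx b ltac:(lra).
set q := Num.sqrt (H ^+ 2 - p ^+ 2).
have q0 : 0 <= q by exact: sqrtr_ge0.
have pq : p ^+ 2 + q ^+ 2 = H ^+ 2.
  by rewrite sqr_sqrtr; [ring|rewrite subr_ge0; nra].
have lip : `|catarea p (rho b) - catarea p (rho a)| <= q * `|rho b - rho a|.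
  have [ab'|ba'] := leP (rho a) (rho b).
    have /andP[l1 l2] := catarea_lip p0 pa ab' bH.
    by rewrite !ger0_norm// subr_ge0.
  have /andP[l1 l2] := catarea_lip p0 pb (ltW ba') aH.
  by rewrite distrC [`|rho b - _|]distrC !ger0_norm// subr_ge0 ltW.
have agi : mu.-integrable `[a, b] (EFin \o (fun x => `|g x|)).
  exact: (integrable_abse gi').
have i1 := integrable_itv_cst a b 1.
have wi := integrable_sub ha bh integrable_arclen.
have step : q * `|rho b - rho a| <= q * \int[mu]_(x in `[a, b]) `|g x|.
  by apply: ler_wpM2l => //; rewrite weak_increment//; exact: le_normr_Rintegral.
have <- : p * \int[mu]_(x in `[a, b]) 1 = p * (b - a).
  by rewrite Rintegral_itv_cst// mul1r.
apply: (@le_trans _ _ (p * \int[mu]_(x in `[a, b]) 1 +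
    q * \int[mu]_(x in `[a, b]) `|g x|)).
  by rewrite lerD2l (le_trans lip).
rewrite -Rintegral_lin// -RintegralZl//.
apply: le_Rintegral => //.
- exact: integrable_lin.
- exact: integrable_scale.
- by move=> x _; rewrite mulr1 arclen_ge//; lra.
Qed.

(* Each short piece obeys the local bound with H within e of [rho]; summing the
   pieces replaces a chain rule for absolutely continuous functions. *)
Lemma energy_ge_catarea p a b : 0 <= h -> - h <= a -> a <= b -> b <= h -> 0 < p ->
  (forall x, a <= x <= b -> p <= rho x) ->
  p * (b - a) + `|catarea p (rho b) - catarea p (rho a)| <=
  \int[mu]_(x in `[a, b]) energy x.
Proof.
move=> h0 ha ab bh p0 Hx.
have wi := integrable_sub ha bh integrable_arclen.
have ei := integrable_sub ha bh (integrable_energy h0).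
suff S k : `|k| = 1 -> p * (b - a) + k * (catarea p (rho b) - catarea p (rho a)) <=
  \int[mu]_(x in `[a, b]) energy x.
  have [d0|d0] := leP 0 (catarea p (rho b) - catarea p (rho a)).
    by rewrite ger0_norm//; have := S 1 (normr1 _); rewrite mul1r.
  by rewrite ltr0_norm//; have := S (- 1) (normrN1 _); rewrite mulN1r.
move=> k1; apply/ler_addgt0Pr => e e0.
set W := \int[mu]_(x in `[a, b]) arclen x.
have W0 : 0 <= W by apply: Rintegral_ge0 => x _; exact: arclen_ge0.
(* An error e' per unit of arc length costs at most e in total; the 1 keeps the denominator positive
   when W = 0. *)
pose e' := e / (W + 1).
have e'0 : 0 < e' by rewrite divr_gt0//; lra.
have e'W : e' * W <= e.
  by rewrite /e' mulrAC ler_pdivrMr; [rewrite ler_pM2l; lra|lra].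
apply: (@le_trans _ _ (\int[mu]_(x in `[a, b]) energy x + e' * W)); last first.
  by rewrite lerD2l.
have e'2 : 0 < e' / 2 by rewrite divr_gt0.
have [d d0 Hd] := weak_unif_cont e'2.
(* The surplus accumulated up to x; the bound on short pieces says that it increases. *)
pose D x := 1 * \int[mu]_(t in `[a, x]) energy t +
  e' * \int[mu]_(t in `[a, x]) arclen t - (p * x + k * catarea p (rho x)).
suff : D a <= D b.
  rewrite /D !set_itv1 !Rintegral_set1 -/W; lra.
apply: (small_step_le d0 ab) => x y ax xy yb xyd.
have hx : - h <= x by lra.
have yh : y <= h by lra.
have e1 : mu.-integrable `[a, y] (EFin \o energy) by exact: integrable_sub ei.
have w1 : mu.-integrable `[a, y] (EFin \o arclen) by exact: integrable_sub wi.
have e2 : mu.-integrable `[x, y] (EFin \o energy) by exact: integrable_sub ei.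
have w2 : mu.-integrable `[x, y] (EFin \o arclen) by exact: integrable_sub wi.
rewrite /D (@Rintegral_cat _ energy a x y)// (@Rintegral_cat _ arclen a x y)//.
(* On a short piece [rho] varies by less than e' / 2, so H = rho x + e' / 2 bounds it above and
   exceeds it by less than e'. *)
have pos z : x <= z <= y -> p <= rho z <= rho x + e' / 2.
  move=> /andP[xz zy]; rewrite Hx/=; last lra.
  have /(_ hx xz) := Hd x z; rewrite ltr_norml => /(_ _ _)/andP.
  by move=> []; lra.
have := catarea_local hx xy yh p0 pos.
have -> : (rho x + e' / 2) * \int[mu]_(t in `[x, y]) arclen t =
  \int[mu]_(t in `[x, y]) ((rho x + e' / 2) * arclen t).
  by rewrite RintegralZl.
have : \int[mu]_(t in `[x, y]) ((rho x + e' / 2) * arclen t) <=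
  1 * \int[mu]_(t in `[x, y]) energy t + e' * \int[mu]_(t in `[x, y]) arclen t.
  rewrite -Rintegral_lin//; apply: le_Rintegral => //.
  - exact: integrable_scale.
  - exact: integrable_lin.
  move=> t /=; rewrite in_itv/= => /andP[xt ty].
  rewrite mul1r /energy -mulrDl; apply: ler_wpM2r; first exact: arclen_ge0.
  have /(_ hx xt) := Hd x t; rewrite ltr_norml => /(_ _ _)/andP.
  by move=> []; lra.
have : k * (catarea p (rho y) - catarea p (rho x)) <=
  `|catarea p (rho y) - catarea p (rho x)|.
  by rewrite (le_trans (ler_norm _))// normrM k1 mul1r.
lra.
Qed.

End Curve.

(** * The catenary and the equality case *)

Section Catenary.
Context {R : realType}.
Notation mu := (@lebesgue_measure R).
Implicit Types (a b h r x Pi : R).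

Lemma derive_continuous (F f : R -> R) : (forall x : R, is_derive x 1 F (f x)) ->
  continuous F.
Proof.
move=> Ff x; apply: differentiable_continuous; apply/derivable1_diffP.
by have [] := Ff x.
Qed.

Lemma Rintegral_FTC2 (F f : R -> R) a b : a <= b ->
  (forall x : R, is_derive x 1 F (f x)) -> continuous f ->
  \int[mu]_(x in `[a, b]) f x = F b - F a.
Proof.
rewrite le_eqVlt => /predU1P[->|ab] Ff cf.
  by rewrite set_itv1 Rintegral_set1 subrr.
have dF x : derivable F x 1 by have [] := Ff x.
have cF := derive_continuous Ff.
rewrite /Rintegral (@continuous_FTC2 _ f F)//.
- exact: continuous_subspaceT.
- split=> [x _| |]; [exact: dF|apply: cvg_at_right_filter; exact: cF|
                     apply: cvg_at_left_filter; exact: cF].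
- by move=> x _; rewrite derive1E; have [] := Ff x.
Qed.

Lemma is_derive_catenary Pi x : 0 < Pi ->
  is_derive x 1 (fun x => Pi * rcosh (x / Pi)) (rsinh (x / Pi)).
Proof.
move=> P0.
have dm : is_derive x 1 (fun x : R => x / Pi) Pi^-1.
  by apply: is_derive_eq; rewrite /GRing.scale/=; ring.
have dc : is_derive x 1 (@rcosh R \o (fun x => x / Pi)) (rsinh (x / Pi) * Pi^-1).
  by have ? := is_derive_rcosh (x / Pi); apply: is_derive1_comp.
have -> : rsinh (x / Pi) = Pi *: (rsinh (x / Pi) * Pi^-1).
  by rewrite /GRing.scale/=; field; rewrite gt_eqF.
exact: (is_deriveZ Pi dc).
Qed.

Lemma is_derive_catenary_slope Pi x : 0 < Pi ->
  is_derive x 1 (fun x => rsinh (x / Pi)) (rcosh (x / Pi) / Pi).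
Proof.
move=> P0.
have dm : is_derive x 1 (fun x : R => x / Pi) Pi^-1.
  by apply: is_derive_eq; rewrite /GRing.scale/=; ring.
by have ? := is_derive_rsinh (x / Pi); apply: is_derive1_comp.
Qed.

Lemma weak_deriv_catenary h Pi : 0 < h -> 0 < Pi ->
  weak_deriv_on h (fun x => Pi * rcosh (x / Pi)) (fun x => rsinh (x / Pi)).
Proof.
move=> h0 P0.
have cs := derive_continuous (fun x => is_derive_catenary_slope x P0).
split.
  apply: continuous_compact_integrable; first exact: segment_compact.
  exact: continuous_subspaceT.
move=> x /[!in_itv]/= /andP[hx xh].
rewrite (Rintegral_FTC2 hx (fun x => is_derive_catenary x P0) cs); ring.
Qed.

(** Lebesgue differentiation of the indefinite integral of [g], which is F - F (-h) near each
    interior point. It serves because the energy of the catenary is computed for an arbitrary weak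
    derivative. *)
Lemma weak_deriv_ae (F f g : R -> R) h : weak_deriv_on h F g ->
  (forall x : R, is_derive x 1 F (f x)) ->
  {ae mu, forall x, - h < x < h -> g x = f x}.
Proof.
move=> Fg Ff; have [gi _] := Fg.
pose G := g \_ `[- h, h].
have Gi A : measurable A -> mu.-integrable A (EFin \o G).
  move=> mA; have i0 : mu.-integrable setT (EFin \o G).
    by rewrite -restrict_EFin; apply/integrable_restrict => //=; rewrite setTI.
  exact: integrableS i0.
have lG : locally_integrable setT G.
  by apply: open_integrable_locally; [exact: openT|exact: Gi].
have := @FTC1 R G (BLeft (- h)) (fun y => Gi _ (measurable_itv _)) lG.
apply: filterS; first exact: (ae_filter_ringOfSetsType mu).
move=> x H /andP[hx xh].
have [_] := H hx.
rewrite /G patchE mem_set/=; last by rewrite in_itv/=; lra.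
move=> <-.
have [_ <-] := Ff x.
rewrite derive1E; apply/esym.
set K := (K in 'D_1 K x).
have -> : 'D_1 F x = 'D_1 (F - cst (F (- h))) x.
  have dF : derivable F x 1 by have [] := Ff x.
  by rewrite deriveB// derive_cst subr0.
apply: near_eq_derive.
have hh : x \in `]- h, h[ by rewrite in_itv/= hx.
near=> y.
have : y \in `]- h, h[ by near: y; exact: near_in_itvoo.
rewrite in_itv/= => /andP[hy yh].
rewrite /K !fctE (weak_increment Fg)// ?ltW//.
apply: eq_Rintegral => z; rewrite inE/= in_itv/= => /andP[hz zy].
by rewrite patchE mem_set//= in_itv/=; lra.
Unshelve. all: by end_near. Qed.

(** Since 1 + sinh ^ 2 = cosh ^ 2, the integrand is almost everywhere Pi cosh ^ 2 (x / Pi), which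
    has an explicit primitive. *)
Lemma energy_catenary h Pi (g : R -> R) : 0 < h -> 0 < Pi ->
  weak_deriv_on h (fun x => Pi * rcosh (x / Pi)) g ->
  \int[mu]_(x in `[- h, h]) energy (fun x => Pi * rcosh (x / Pi)) g x =
  2 * (Pi * h + catarea Pi (Pi * rcosh (h / Pi))).
Proof.
move=> h0 P0 wg.
set rho0 := fun x => _.
have ei := integrable_energy wg (ltW h0).
have dcP x : is_derive x 1 (fun x => Pi * (rcosh (x / Pi) * rcosh (x / Pi)))
    (2 * rcosh (x / Pi) * rsinh (x / Pi)).
  have := is_derive_catenary x P0 => d1.
  have d2 : is_derive x 1 (fun x => rcosh (x / Pi)) (rsinh (x / Pi) / Pi).
    rewrite (_ : (fun x => _) = (fun x => Pi^-1 * (Pi * rcosh (x / Pi)))).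
      by apply: is_derive_eq; rewrite /GRing.scale/=; field; rewrite gt_eqF.
    by apply/funext => z; field; rewrite gt_eqF.
  by apply: is_derive_eq; rewrite /GRing.scale/=; field; rewrite gt_eqF.
have cP := derive_continuous dcP.
transitivity (\int[mu]_(x in `[- h, h]) (Pi * (rcosh (x / Pi) * rcosh (x / Pi)))).
  have ci : mu.-integrable `[- h, h]
      (EFin \o (fun x => Pi * (rcosh (x / Pi) * rcosh (x / Pi)))).
    apply: continuous_compact_integrable; first exact: segment_compact.
    exact: continuous_subspaceT.
  (* The two integrands are compared on the open interval, where the derivative is known almost
     everywhere. *)
  have oo f : mu.-integrable `[- h, h] (EFin \o f) ->
      \int[mu]_(x in `[- h, h]) f x = \int[mu]_(x in `]- h, h[) f x.
    move=> fi; rewrite -Rintegral_itv_obnd_cbnd ?Rintegral_itv_bndo_bndc//.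
      by apply: integrableS fi => //; apply: subset_itv; rewrite bnd_simp.
    by apply: integrableS fi => //; apply: subset_itv; rewrite bnd_simp.
  rewrite !oo// /Rintegral; congr fine.
  have sub : `]- h, h[%classic `<=` `[- h, h]%classic.
    by apply: subset_itv; rewrite bnd_simp.
  apply: ae_eq_integral => //.
  - apply: measurable_funS sub _ => //; exact: measurable_int ei.
  - apply: measurable_funS sub _ => //; exact: measurable_int ci.
  have := weak_deriv_ae wg (fun x => is_derive_catenary x P0).
  apply: filterS; first exact: (ae_filter_ringOfSetsType mu).
  move=> x H /=; rewrite in_itv/= => hx.
  rewrite /energy /arclen H// -rcosh2 sqrtr_sqr ger0_norm ?mulrA//.
  by rewrite ltW// rcosh_gt0.
have dF x : is_derive x 1
   (fun x => Pi / 2 * ((Pi * rcosh (x / Pi)) * rsinh (x / Pi) + x))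
   (Pi * (rcosh (x / Pi) * rcosh (x / Pi))).
  have := is_derive_catenary x P0 => d1.
  have := is_derive_catenary_slope x P0 => d2.
  apply: is_derive_eq; rewrite /GRing.scale/=.
  have := rcosh2 (x / Pi).
  move: (rcosh _) (rsinh _) => C S E.
  transitivity (Pi / 2 * (C ^+ 2 + S ^+ 2 + 1)); first by field; rewrite gt_eqF.
  have -> : S ^+ 2 = C ^+ 2 - 1 by rewrite E; ring.
  by field.
have hh : - h <= h by lra.
rewrite (Rintegral_FTC2 hh dF cP) /catarea.
rewrite (_ : Pi * rcosh (h / Pi) / Pi = rcosh (h / Pi)); last first.
  by field; rewrite gt_eqF.
rewrite rcoshK ?divr_ge0 ?ltW// mulNr rcoshN rsinhN.
by field; rewrite gt_eqF.
Qed.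

Lemma in_X_catenary h Pi : 0 < h -> 0 < Pi ->
  in_X h (Pi * rcosh (h / Pi)) (fun x => Pi * rcosh (x / Pi)).
Proof.
move=> h0 P0; split; first by eexists; exact: weak_deriv_catenary.
split; first by move=> x _; rewrite mulr_gt0// rcosh_gt0.
by rewrite mulNr rcoshN.
Qed.

End Catenary.

(** * An arbitrary competitor: the bound at its minimum and the equality case *)

Section Competitor.
Context {R : realType}.
Notation mu := (@lebesgue_measure R).
Variables (h r : R) (rho g : R -> R).
Hypotheses (h0 : 0 < h) (rhoX : in_X h r rho) (rhog : weak_deriv_on h rho g).

Let E a b := \int[mu]_(x in `[a, b]) energy rho g x.

Let E_cat a b c : - h <= a -> a <= b -> b <= c -> c <= h -> E a c = E a b + E b c.
Proof.
move=> ha ab bc ch; apply: Rintegral_cat => //.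
exact: (integrable_sub ha ch (integrable_energy rhog (ltW h0))).
Qed.

Let rho_l : rho (- h) = r. Proof. by have [_ [_ []]] := rhoX. Qed.
Let rho_r : rho h = r. Proof. by have [_ [_ []]] := rhoX. Qed.

Lemma competitor_min : exists2 z, - h <= z <= h &
  0 < rho z /\ forall x, - h <= x <= h -> rho z <= rho x.
Proof.
have hh : - h <= h by move: h0; lra.
have [z zI Hz] := EVT_min hh (weak_continuous rhog).
have [_ [pos _]] := rhoX.
exists z; first by move: zI; rewrite in_itv.
by split; [exact: pos|move=> x hx; apply: Hz; rewrite in_itv].
Qed.

Section Minimum.
Variable z : R.
Hypotheses (zh : - h <= z <= h) (z0 : 0 < rho z).
Hypothesis zmin : forall x, - h <= x <= h -> rho z <= rho x.
Let m := rho z.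

Let lower p a b : - h <= a -> a <= b -> b <= h -> 0 < p -> p <= m ->
  p * (b - a) + `|catarea p (rho b) - catarea p (rho a)| <= E a b.
Proof.
move=> ha ab bh p0 pm; apply: (energy_ge_catarea rhog) => //; first exact: ltW.
by move=> x /andP[ax xb]; apply: (le_trans pm); apply: zmin; lra.
Qed.

(** The lower bound with p = m is used on [-h, z] and on [z, h]. As [catarea m m] is 0, each side
    contributes [catarea m r], and the lengths add up to 2 h wherever z lies. *)
Lemma energy_ge_min : 2 * (m * h + catarea m r) <= E (- h) h.
Proof.
move: zh => /andP[hz zh'].
have l1 := lower (lexx _) hz zh' z0 (lexx _).
have l2 := lower hz zh' (lexx _) z0 (lexx _).
rewrite (@E_cat (- h) z h)//.
move: l1 l2; rewrite rho_l rho_r -/m !catarea_id// subr0 sub0r normrN => l1 l2.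
have := ler_norm (catarea m r); lra.
Qed.

Hypothesis E_le : E (- h) h <= 2 * (m * h + catarea m r).

(* Equality on [-h, h] forces equality on every subinterval; letting p tend to
   m from below in the lower bound then yields the claim. *)
Let gap_right a b : z <= a -> a <= b -> b <= h ->
  m * acosh (rho b / m) - m * acosh (rho a / m) <= b - a.
Proof.
move=> za ab bh; move: zh => /andP[hz zh'].
have ha : - h <= a by lra.
have hb : - h <= b by lra.
have ah : a <= h by lra.
have ma : m <= rho a by apply: zmin; lra.
have mb : m <= rho b by apply: zmin; lra.
apply: acosh_gap => // p p0 pm.
(* The constant is p on [a, b] only and m on the other three pieces. Subtracting the sum from [E_le]
   leaves the hypothesis of [acosh_gap]. *)
have l1 := lower (lexx _) hz zh' z0 (lexx _).
have l2 := lower hz za ah z0 (lexx _).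
have l3 := lower ha ab bh p0 (ltW pm).
have l4 := lower hb bh (lexx _) z0 (lexx _).
move: E_le; rewrite (@E_cat (- h) z h)// (@E_cat z a h)// (@E_cat a b h)//.
move: l1 l2 l3 l4; rewrite rho_l rho_r -/m !catarea_id// subr0 sub0r normrN.
have := ler_norm (catarea m r).
have := ler_norm (catarea m (rho a)).
have := ler_norm (catarea p (rho b) - catarea p (rho a)).
have := ler_norm (catarea m r - catarea m (rho b)).
lra.
Qed.

(** The mirror image of [gap_right], with the roles of the endpoints exchanged. *)
Let gap_left a b : - h <= a -> a <= b -> b <= z ->
  m * acosh (rho a / m) - m * acosh (rho b / m) <= b - a.
Proof.
move=> ha ab bz; move: zh => /andP[hz zh'].
have bh : b <= h by lra.
have ah : a <= h by lra.
have hb : - h <= b by lra.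
have ma : m <= rho a by apply: zmin; lra.
have mb : m <= rho b by apply: zmin; lra.
apply: acosh_gap => // p p0 pm.
have l1 := lower (lexx _) ha ah z0 (lexx _).
have l2 := lower ha ab bh p0 (ltW pm).
have l3 := lower hb bz zh' z0 (lexx _).
have l4 := lower hz zh' (lexx _) z0 (lexx _).
have az : a <= z by lra.
move: E_le; rewrite (@E_cat (- h) z h)// (@E_cat (- h) a z)// (@E_cat a b z)//.
move: l1 l2 l3 l4; rewrite rho_l rho_r -/m !catarea_id// subr0 sub0r normrN.
rewrite distrC [`|catarea p _ - _|]distrC.
have := ler_norm (catarea m r).
have := ler_norm (catarea m (rho b)).
have := ler_norm (catarea p (rho a) - catarea p (rho b)).
have := ler_norm (catarea m r - catarea m (rho a)).
lra.
Qed.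

Lemma minimizer_catenary : r = m * rcosh (h / m) ->
  forall x, - h <= x <= h -> rho x = m * rcosh (x / m).
Proof.
move=> rE x /andP[hx xh]; move: zh => /andP[hz zh'].
have mr : m * acosh (r / m) = h.
  rewrite rE (_ : m * rcosh (h / m) / m = rcosh (h / m)); last first.
    by field; rewrite gt_eqF.
  by rewrite rcoshK ?divr_ge0 ?ltW//; field; rewrite gt_eqF.
have mm : m * acosh (m / m) = 0.
  by rewrite divff ?gt_eqF// -rcosh0 rcoshK// mulr0.
(* The quantity m acosh (rho / m) climbs from 0 at z to h at both ends, so h <= h - z and h <= z +
   h. *)
have zE : z = 0.
  have := gap_right (lexx _) zh' (lexx _); have := gap_left (lexx _) hz (lexx _).
  rewrite rho_l rho_r -/m mm mr; lra.
have rxE t : m * acosh (rho x / m) = t -> rho x = m * rcosh (t / m).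
  have rx1 : 1 <= rho x / m by rewrite ler_pdivlMr// mul1r zmin// hx.
  move=> <-; rewrite (_ : m * acosh _ / m = acosh (rho x / m)); last first.
    by field; rewrite gt_eqF.
  by rewrite acoshK//; field; rewrite gt_eqF.
(* For x >= 0 the gap bound on [0, x] gives m acosh (rho x / m) <= x, and the one on [x, h] gives
   the reverse inequality; negative x is symmetric. *)
have [x0|x0] := leP 0 x.
  have zx : z <= x by rewrite zE.
  apply: rxE.
  have := gap_right (lexx _) zx xh; have := gap_right zx xh (lexx _).
  rewrite rho_r -/m mm mr zE; lra.
have xz : x <= z by rewrite zE ltW.
rewrite -(rcoshN (x / m)) -mulNr; apply: rxE.
have := gap_left hx xz (lexx _); have := gap_left (lexx _) hx xz.
rewrite rho_l -/m mm mr zE; lra.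
Qed.

End Minimum.
End Competitor.

(** As [E0] takes the derivative as an argument, [g0] and [g] range over all weak derivatives.
    Uniqueness says that a competitor with energy at most that of the catenary agrees with it at
    every point of [-h, h]. *)
Theorem theorem3p3 (R : realType) (h r : R) (hpos : 0 < h) (rpos : 0 < r)
  (Xi : R) (Xi_pos : 0 < Xi) (Xi_sol : Xi_eq Xi)
  (Xi_uniq : forall xi : R, 0 < xi -> Xi_eq xi -> xi = Xi)
  (Pi0 : R) (Pi0_pos : 0 < Pi0) (Pi0_sol : r = Pi0 * rcosh (h / Pi0))
  (Pi0_max : forall Pi : R, 0 < Pi -> r = Pi * rcosh (h / Pi) -> Pi <= Pi0) :
  h / r <= 1 / (Xi * rcosh (1 / Xi)) ->
  let rho0 := fun x : R => Pi0 * rcosh (x / Pi0) in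
  in_X h r rho0 /\
  forall (g0 rho g : R -> R),
    weak_deriv_on h rho0 g0 -> in_X h r rho -> weak_deriv_on h rho g ->
    (E0 h rho0 g0 <= E0 h rho g)%E /\
    ((E0 h rho g <= E0 h rho0 g0)%E -> forall x, x \in `[- h, h] -> rho x = rho0 x).
Proof.
move=> hr rho0; split; first by rewrite Pi0_sol; exact: in_X_catenary.
move=> g0 rho g wg0 rhoX wg.
rewrite (E0E wg0 (ltW hpos)) (E0E wg (ltW hpos)) !lee_fin.
rewrite (energy_catenary hpos Pi0_pos wg0) -Pi0_sol.
have [z zh [z0 zmin]] := competitor_min hpos rhoX wg.
have Ez := energy_ge_min hpos rhoX wg zh z0 zmin.
have zr : rho z <= r.
  have [_ [_ [_ <-]]] := rhoX; apply: zmin; lra.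
have Pmin := cat_energy_min hpos rpos Xi_pos Xi_sol Pi0_pos Pi0_sol Pi0_max hr z0 zr.
(* If the minimum of [rho] differs from Pi0, its energy is strictly larger, so the uniqueness
   premise fails. Otherwise the lower bound is the energy of the catenary itself, and equality puts
   [rho] in the scope of [minimizer_catenary]. *)
have [zP|zP] := eqVneq (rho z) Pi0; last first.
  have := Pmin zP; split; first lra.
  by move=> le; exfalso; lra.
rewrite zP in Ez; split=> // le x; rewrite in_itv/= => xh.
rewrite /rho0 -zP; apply: (minimizer_catenary hpos rhoX wg zh z0 zmin) => //.
  by rewrite zP.
by rewrite zP.
Qed.
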